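(* The stiffness matrix $S$ satisfies $S^{-1}=\tilde G$, where $\tilde G=[G(x_i,x_j)]_{i,j=1,\dots,n-1}$. Consequently, for $f$ continuous on $[0,1]$, the finite element coefficient vector $u^{FE}$, defined by $S\,u^{FE}=F$ with $F=[(f,\varphi_1),\dots,(f,\varphi_{n-1})]^T$, is given by $u^{FE}=S^{-1}F=\tilde G F$.
   Context: Let $n\ge 2$, let $0=x_0<x_1<\cdots<x_n=1$ be arbitrary (possibly non-uniformly spaced) nodes, and let $h_j=x_j-x_{j-1}$ for $j=1,\dots,n$. $S$ is the symmetric tridiagonal $(n-1)\times(n-1)$ matrix with entries $S_{jj}=\frac1{h_j}+\frac1{h_{j+1}}$ for $1\le j\le n-1$, $S_{j,j+1}=S_{j+1,j}=-\frac1{h_{j+1}}$ for $1\le j\le n-2$, and all other entries zero (equivalently, $S_{ij}=\int_0^1\varphi_i'\varphi_j'\,dx$). Here $\varphi_j$, $1\le j\le n-1$, are the continuous functions on $[0,1]$ that are linear on each $[x_k,x_{k+1}]$, with $\varphi_j(x_k)=\delta_{jk}$ for $0\le k\le n$, and $(f,v)=\int_0^1 f(x)v(x)\,dx$. The Green function is $G(x,s)=s(1-x)$ if $0\le s\le x$ and $G(x,s)=x(1-s)$ if $x<s\le1$. *)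

(* Defs.v *)
From HB Require Import structures.
From mathcomp Require Import all_boot all_order all_algebra.
From mathcomp Require Import all_classical all_reals all_analysis.

Set Implicit Arguments.
Unset Strict Implicit.
Unset Printing Implicit Defensive.

Import Order.TTheory GRing.Theory Num.Theory.
Import numFieldNormedType.Exports.

Local Open Scope classical_set_scope.
Local Open Scope ring_scope.

(* Nodes are a sequence x : nat -> R of which only x 0, ..., x n are used;
   interior nodes are numbered 1, ..., n - 1, so that the entry of a matrix
   or vector at the ordinal i : 'I_n.-1 belongs to the node number i.+1. *)

Definition mesh_step (R : realType) (x : nat -> R) (j : nat) : R :=
  x j - x j.-1.

Definition stiffness_entry (R : realType) (x : nat -> R) (i j : nat) : R :=
  if i == j then (mesh_step x j)^-1 + (mesh_step x j.+1)^-1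
  else if j == i.+1 then - (mesh_step x i.+1)^-1
  else if i == j.+1 then - (mesh_step x j.+1)^-1
  else 0.

Definition stiffness (R : realType) (n : nat) (x : nat -> R) : 'M[R]_(n.-1) :=
  \matrix_(i, j) stiffness_entry x i.+1 j.+1.

Definition green (R : realType) (x s : R) : R :=
  if s <= x then s * (1 - x) else x * (1 - s).

Definition green_mx (R : realType) (n : nat) (x : nat -> R) : 'M[R]_(n.-1) :=
  \matrix_(i, j) green (x i.+1) (x j.+1).

(* The conditions determine phi j on `[0, 1] for 1 <= j <= n - 1; the values
   outside this interval and for other j are left arbitrary. *)
Definition hat_functions (R : realType) (n : nat) (x : nat -> R)
    (phi : nat -> R -> R) : Prop :=
  forall j : nat, (0 < j < n)%N ->
  [/\ {within `[0, 1], continuous (phi j)},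
      (forall k : nat, (k < n)%N -> exists a b : R,
         forall t : R, t \in `[x k, x k.+1] -> phi j t = a * t + b) &
      (forall k : nat, (k <= n)%N -> phi j (x k) = (j == k)%:R)].

Definition inner01 (R : realType) (f v : R -> R) : R :=
  \int[@lebesgue_measure R]_(t in `[0, 1]) (f t * v t).

Definition load_vector (R : realType) (n : nat) (phi : nat -> R -> R)
    (f : R -> R) : 'cV[R]_(n.-1) :=
  \col_i inner01 f (phi i.+1).

(* Main.v *)
Require Import Defs.
From HB Require Import structures.
From mathcomp Require Import all_boot all_order all_algebra.
From mathcomp Require Import all_classical all_reals all_analysis.
From mathcomp Require Import ring zify.

(* [stiffness] acts on a grid function vanishing at both end nodes as minus the
   difference of its slopes on the two cells adjacent to a node. As a function
   of its first argument, [green _ s] is affine on each side of [s], with slope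
   [1 - s] before and [- s] after: the jump of the slope is [- 1], and it occurs
   at [s] only. Applied to the columns of [green_mx], [stiffness] thus gives the
   identity matrix. *)

Set Implicit Arguments.
Unset Strict Implicit.
Unset Printing Implicit Defensive.

Import Order.TTheory GRing.Theory Num.Theory.
Import numFieldNormedType.Exports.

Local Open Scope classical_set_scope.
Local Open Scope ring_scope.

(** Writing a row as three Kronecker deltas in the column index [k] lets each part of a sum over [k]
    collapse to one term. With [0 < i], the index [i.-1] is a genuine left neighbour, distinct from
    [i]. *)
Lemma stiffness_entryE (R : realType) (x : nat -> R) (i k : nat) : (0 < i)%N ->
  stiffness_entry x i k =
    (if k == i then (mesh_step x i)^-1 + (mesh_step x i.+1)^-1 else 0)
    - (if k == i.+1 then (mesh_step x i.+1)^-1 else 0)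
    - (if k == i.-1 then (mesh_step x i)^-1 else 0).
Proof.
case: i => // i _; rewrite /stiffness_entry /=.
by do !case: eqP => ?; subst; try lia; rewrite ?subr0 ?sub0r.
Qed.

Lemma stiffness_sum (R : realType) (n : nat) (x g : nat -> R) (i : nat) :
  (0 < i < n)%N -> g 0%N = 0 -> g n = 0 ->
  \sum_(k < n.-1) stiffness_entry x i k.+1 * g k.+1 =
    (g i - g i.-1) / mesh_step x i - (g i.+1 - g i) / mesh_step x i.+1.
Proof.
move=> /andP[i0 ltin] g0 gn.
have n0 : (0 < n)%N by apply: leq_trans ltin.
(* The added columns [0] and [n] contribute nothing since [g] vanishes there; with them, the first
   and last rows have both neighbours in range like every other row. *)
have -> : \sum_(k < n.-1) stiffness_entry x i k.+1 * g k.+1 =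
          \sum_(0 <= k < n.+1) stiffness_entry x i k * g k.
  rewrite big_nat_recl // g0 mulr0 add0r -(big_mkord xpredT
    (fun k => stiffness_entry x i k.+1 * g k.+1)).
  by rewrite -[in RHS](prednK n0) big_nat_recr //= prednK // gn mulr0 addr0.
have delta j c : (j <= n)%N ->
    \sum_(0 <= k < n.+1) (if k == j then c else 0) * g k = c * g j.
  move=> ljn; under eq_bigr => k _ do rewrite (fun_if (fun c => c * g k)) mul0r.
  by rewrite -big_mkcond big_nat1_eq /= ltnS ljn.
under eq_bigr => k _ do rewrite (stiffness_entryE _ _ i0) !mulrBl.
rewrite !sumrB !delta //; [ring | lia | lia].
Qed.

Lemma green_le (R : realType) (x s : R) : x <= s -> green x s = x * (1 - s).
Proof.
rewrite /green => xs; case: ifP => // sx.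
by rewrite (_ : x = s) //; apply: le_anti; rewrite xs.
Qed.

Lemma green_ge (R : realType) (x s : R) : s <= x -> green x s = s * (1 - x).
Proof. by rewrite /green => ->. Qed.

Lemma stiffness_mul_green (R : realType) (n : nat) (x : nat -> R) :
  x 0%N = 0 -> x n = 1 -> (forall k : nat, (k < n)%N -> x k < x k.+1) ->
  stiffness n x *m green_mx n x = 1%:M.
Proof.
move=> x0 xn x_incr.
have x_mono k l : (k <= l)%N -> (l <= n)%N -> x k <= x l.
  elim: l => [|l IH]; first by rewrite leqn0 => /eqP->.
  rewrite leq_eqVlt ltnS => /predU1P[->//|kl] ln.
  exact: le_trans (IH kl (ltnW ln)) (ltW (x_incr _ ln)).
apply/matrixP => i j; rewrite !mxE.
under eq_bigr => k _ do rewrite !mxE.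
have [iN jN] : (i.+1 < n)%N /\ (j.+1 < n)%N.
  by have := ltn_ord i; have := ltn_ord j; lia.
rewrite (@stiffness_sum R n x (fun k => green (x k) (x j.+1))) ?iN //;
  first last.
- by rewrite green_ge ?x_mono // ?xn ?subrr ?mulr0 // ltnW.
- by rewrite green_le ?x_mono // ?x0 ?mul0r // ltnW.
rewrite /mesh_step /=.
have h1 : x i.+1 - x i != 0 by rewrite subr_eq0 gt_eqF // x_incr // ltnW.
have h2 : x i.+2 - x i.+1 != 0 by rewrite subr_eq0 gt_eqF // x_incr.
rewrite -val_eqE /=.
(* The three nodes [x i], [x i.+1], [x i.+2] all lie on one side of the source [x j.+1] unless
   [i = j]; then the middle node is the source and the slopes differ across it. *)
have [ij|ij|ij] := ltngtP (i : nat) (j : nat).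
- rewrite mulr0n !green_le ?x_mono //; try lia.
  by field; rewrite h1 h2.
- rewrite mulr0n !green_ge ?x_mono //; try lia.
  by field; rewrite h1 h2.
- rewrite ij in h1 h2 *.
  rewrite mulr1n (green_ge (x := x j.+2)) ?x_mono //
    !green_le ?x_mono //; try lia.
  by field; rewrite h1 h2.
Qed.

Theorem corollary2p4 (R : realType) (n : nat) (x : nat -> R)
    (hn : (2 <= n)%N)
    (x_first : x 0%N = 0) (x_last : x n = 1)
    (x_incr : forall k : nat, (k < n)%N -> x k < x k.+1) :
  [/\ stiffness n x \in unitmx,
      invmx (stiffness n x) = green_mx n x &
      forall phi : nat -> R -> R, hat_functions n x phi ->
      forall f : R -> R, {within `[0, 1], continuous f} ->
        (forall u : 'cV[R]_(n.-1),
           stiffness n x *m u = load_vector n phi f <->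
           u = invmx (stiffness n x) *m load_vector n phi f) /\
        invmx (stiffness n x) *m load_vector n phi f =
          green_mx n x *m load_vector n phi f].
Proof.
have SG := stiffness_mul_green x_first x_last x_incr.
(* For square matrices a right inverse already gives invertibility, so the product in the other
   order need not be computed. *)
have [unitS _] := mulmx1_unit SG.
have invS : invmx (stiffness n x) = green_mx n x.
  by rewrite -[LHS]mulmx1 -SG mulKmx.
split=> // phi _ f _; split; last by rewrite invS.
by move=> u; split=> [<-|->]; rewrite ?mulKmx ?mulKVmx.
Qed.
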